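(* Let $G_n^6$ be the ladder $P_2\square P_n$, i.e. the graph with vertices $v_i,w_i$ ($i=1,\dots,n$) and edges $v_iv_{i+1},w_iw_{i+1}$ ($i=1,\dots,n-1$) and $v_iw_i$ ($i=1,\dots,n$). Then $$\lim_{n\to\infty}\mathcal{I}(G_n^6)=\frac{2r^4-r^2+3r+4}{2r^4+4r+5},\qquad r=\frac13\Big(1+\sqrt[3]{\tfrac{47+3\sqrt{93}}{2}}+\sqrt[3]{\tfrac{47-3\sqrt{93}}{2}}\Big).$$
   Context: For a finite simple graph $G$: a matching is a set of pairwise vertex-disjoint edges; it is maximal if not contained in a larger matching. $\nu(G)$ is the maximum matching size, $\mathcal{T}_0(G)$ the number of maximal matchings, $\mathcal{T}_1(G)$ the sum of the sizes of all maximal matchings, and $\mathcal{I}(G)=\frac{\mathcal{T}_1(G)}{\nu(G)\mathcal{T}_0(G)}$ (equal to $1$ by convention if $\nu(G)=0$). *)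

(* Defs.v *)
From HB Require Import structures.
From mathcomp Require Import all_boot all_order all_algebra.
From mathcomp Require Import reals.

Set Implicit Arguments.
Unset Strict Implicit.
Unset Printing Implicit Defensive.

Record sgraph := SGraph {
  vertex : finType;
  adj : rel vertex;
  adj_sym : symmetric adj;
  adj_irrefl : irreflexive adj }.

(* An edge is the two-element set of its endpoints. *)
Definition edges (G : sgraph) : {set {set vertex G}} :=
  [set e : {set vertex G} |
    [exists x, exists y, adj x y && (e == [set x; y])]].

Definition matching (G : sgraph) (M : {set {set vertex G}}) : bool :=
  (M \subset edges G) && trivIset M.

Definition maximal_matchings (G : sgraph) : {set {set {set vertex G}}} :=
  [set M : {set {set vertex G}} | maxset (@matching G) M].

Definition nu (G : sgraph) : nat :=
  \max_(M : {set {set vertex G}} | matching M) #|M|.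

Definition T0 (G : sgraph) : nat := #|maximal_matchings G|.

Definition T1 (G : sgraph) : nat := \sum_(M in maximal_matchings G) #|M|.

Definition avgI (R : realType) (G : sgraph) : R :=
  if nu G == 0 then 1%R else ((T1 G)%:R / ((nu G)%:R * (T0 G)%:R))%R.

(* The vertices (false, i) and (true, i), for i = 0, ..., n - 1, are the
   v_(i+1) and w_(i+1) of the ladder. *)
Definition ladder_adj (n : nat) : rel (bool * 'I_n) := fun x y =>
  ((x.1 == y.1) && ((x.2.+1 == y.2 :> nat) || (y.2.+1 == x.2 :> nat)))
  || ((x.1 != y.1) && (x.2 == y.2)).

Lemma ladder_adj_sym n : symmetric (@ladder_adj n).
Proof.
move=> x y; rewrite /ladder_adj [y.1 == x.1]eq_sym [y.2 == x.2]eq_sym.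
by rewrite [X in _ && X || _]orbC.
Qed.

Lemma ladder_adj_irrefl n : irreflexive (@ladder_adj n).
Proof. by move=> x; rewrite /ladder_adj !eqxx /= orbF orbb gtn_eqF. Qed.

Definition ladder (n : nat) : sgraph :=
  SGraph (@ladder_adj_sym n) (@ladder_adj_irrefl n).

(* Main.v *)
(* Record the maximal matchings of a graph in the polynomial sum of X^|M|, whose
   value and derivative at X = 1 are T0 and T1.  A set of edges of the ladder is
   a word over the eight possible columns (rung, two edges to the next column),
   and being a maximal matching is recognized by an automaton; up to swapping
   the rows it has five relevant states, and eliminating them gives
     A_(n+5) = 2 X A_(n+4) + (X^2 - X^3) A_(n+2) + X^3 A_(n+1) + X^4 A_n.
   At X = 1 the characteristic polynomial is P(z) = z^5 - 2 z^4 - z - 1, and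
   differentiating at X = 1 shows that b_n = A_n'(1) satisfies the recurrence of
   a_n = A_n(1) with the forcing term E(S) a, where S is the shift and
   E(z) = 2 z^4 - z^2 + 3 z + 4.  All roots of P other than r have modulus less
   than r, so a_n / r^n converges to some c > 0, the differences of b_n / r^n
   converge to c E(r) / (r P'(r)), and by Cesaro b_n / (n a_n) tends to
   E(r) / (r P'(r)).  Since nu = n and r P'(r) = 2 r^4 + 4 r + 5, this is the
   claim. *)
Require Import Defs.
From mathcomp Require Import all_classical all_reals all_analysis.
From mathcomp Require Import all_boot all_order all_algebra.
From mathcomp Require Import ring lra zify.

Set Implicit Arguments.
Unset Strict Implicit.
Unset Printing Implicit Defensive.

Import Order.TTheory GRing.Theory Num.Theory.
Import numFieldNormedType.Exports.

(** * Maximal matchings and vertex degrees *)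

Definition degree (T : finType) (M : {set {set T}}) (x : T) : nat :=
  #|[set e in M | x \in e]|.

Lemma degree_gt0 (T : finType) (M : {set {set T}}) x :
  (0 < degree M x) = (x \in cover M).
Proof.
apply/card_gt0P/bigcupP => [[e]|[e eM xe]]; last by exists e; rewrite inE eM.
by rewrite inE => /andP[eM xe]; exists e.
Qed.

Lemma trivIset_degreeP (T : finType) (M : {set {set T}}) :
  reflect (forall x, degree M x <= 1) (trivIset M).
Proof.
apply: (iffP trivIsetP) => [tM x|degM A B AM BM]; last first.
  apply: contraR => /pred0Pn[x /= /andP[xA xB]].
  by apply/eqP/(card_le1_eqP (degM x)); rewrite inE ?AM ?BM.
apply/card_le1_eqP => A B; rewrite !inE => /andP[AM xA] /andP[BM xB].
apply/eqP; apply: contraT => /(tM _ _ BM AM)/pred0P/(_ x).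
by rewrite /= xA xB.
Qed.

Section Graph.
Variable G : sgraph.
Implicit Types (e : {set vertex G}) (M : {set {set vertex G}}).

Lemma card_edge e : e \in edges G -> #|e| = 2.
Proof.
rewrite inE => /existsP[x /existsP[y /andP[xy /eqP->]]].
by rewrite cards2; case: eqVneq xy => // ->; rewrite adj_irrefl.
Qed.

Lemma card_matching M : matching M -> #|M|.*2 <= #|vertex G|.
Proof.
case/andP=> /subsetP ME /eqP tM; rewrite -muln2 -sum_nat_const.
rewrite -(eq_bigr _ (fun e eM => card_edge (ME e eM))) tM; exact: max_card.
Qed.

Lemma maximal_matchingP M :
  reflect (matching M
           /\ forall e, e \in edges G -> exists2 x, x \in e & 0 < degree M x)
          (maxset (@matching G) M).
Proof.
apply: (iffP maxsetP) => -[mM maxM]; split=> //.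
  move=> e eG; have /card_gt0P[x xe] : 0 < #|e| by rewrite card_edge.
  have [/existsP[y /andP[ye yM]]|/existsPn disj] :=
    boolP [exists y, (y \in e) && (0 < degree M y)]; first by exists y.
  exists x => //.
  have /andP[ME tM] := mM; rewrite degree_gt0; apply/bigcupP; exists e => //.
  rewrite -(maxM (e |: M)) ?setU11 ?subsetUr // /matching subUset sub1set eG ME.
  rewrite trivIsetU ?/trivIset /cover ?big_set1 //= -/(cover M).
  by apply/pred0P => y /=; apply/negbTE; rewrite -degree_gt0.
move=> B /andP[BG tB] MB; apply/eqP; rewrite eqEsubset MB andbT.
apply/subsetP => e eB; have [x xe] := maxM _ (subsetP BG _ eB).
rewrite degree_gt0 => /bigcupP[f fM xf].
have /trivIset_degreeP/(_ x)/card_le1_eqP deg_x := tB.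
by rewrite (deg_x f e) // inE ?xe ?eB ?xf ?(subsetP MB).
Qed.

End Graph.

Local Open Scope ring_scope.

Definition maximal_matching_poly (K : nzSemiRingType) (G : sgraph) : {poly K} :=
  \sum_(M in maximal_matchings G) 'X^#|M|.

Lemma maximal_matching_poly_at1 (K : nzSemiRingType) (G : sgraph) :
  (maximal_matching_poly K G).[1] = (T0 G)%:R.
Proof.
rewrite horner_sum /T0 -sum1_card natr_sum.
by apply: eq_bigr => M _; rewrite hornerXn expr1n.
Qed.

Lemma deriv_maximal_matching_poly_at1 (K : nzSemiRingType) (G : sgraph) :
  (maximal_matching_poly K G)^`().[1] = (T1 G)%:R.
Proof.
rewrite raddf_sum /= horner_sum /T1 natr_sum.
by apply: eq_bigr => M _; rewrite derivXn hornerMn hornerXn expr1n.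
Qed.

(** * The transfer-matrix method *)

Section Automaton.
Variables (S : Type) (C : finType).
Variables (step : S -> C -> option S) (final : pred S).

Fixpoint accepts (s : S) (w : seq C) : bool :=
  if w is c :: w' then oapp (accepts^~ w') false (step s c) else final s.

Variables (K : pzSemiRingType) (weight : C -> K).

Definition word_sum (k : nat) (s : S) : K :=
  \sum_(w : k.-tuple C | accepts s w) \prod_(c <- w) weight c.

Lemma word_sum0 s : word_sum 0 s = (final s)%:R.
Proof.
rewrite /word_sum big_mkcond (bigD1 [tuple]) //= big_nil big1 ?addr0.
  by case: (final s).
by move=> w /negP[]; rewrite tuple0.
Qed.

Lemma word_sumS k s :
  word_sum k.+1 s
  = \sum_c oapp (fun s' => weight c * word_sum k s') 0 (step s c).
Proof.
have consK : bijective (fun p : C * k.-tuple C => [tuple of p.1 :: p.2]).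
  exists (fun w => (thead w, [tuple of behead w])) => [[c w]|w] /=.
    by congr pair; apply/val_inj.
  by rewrite [RHS]tuple_eta; apply/val_inj.
rewrite /word_sum (reindex _ (onW_bij _ consK)) big_mkcond /=.
rewrite -(pair_bigA _ (fun c (w : k.-tuple C) => if accepts s (c :: w) then
   \prod_(d <- c :: w) weight d else 0)) /=.
apply: eq_bigr => c _; case: (step s c) => [s'|] /=; last by rewrite big1.
by rewrite mulr_sumr -big_mkcond; apply: eq_bigr => w _; rewrite big_cons.
Qed.

Lemma word_sum_symmetry (f : S -> S) (g : C -> C) :
  bijective g -> (forall c, weight (g c) = weight c) ->
  (forall s c, step (f s) (g c) = omap f (step s c)) ->
  (forall s, final (f s) = final s) ->
  forall k s, word_sum k (f s) = word_sum k s.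
Proof.
move=> g_bij weight_g step_g final_f; elim=> [|k IH] s.
  by rewrite !word_sum0 final_f.
rewrite !word_sumS (reindex g (onW_bij _ g_bij)); apply: eq_bigr => c _.
by rewrite step_g weight_g; case: (step s c) => //= s'; rewrite IH.
Qed.

End Automaton.

Local Open Scope nat_scope.

(** * Edge sets of the ladder as words *)

(* The rung of the column, then the edges to the next column in rows [false]
   and [true]; as arguments of [selects], these are [None], [Some false] and
   [Some true]. *)
Definition column := (bool * bool * bool)%type.

Definition selects (o : option bool) (c : column) : bool :=
  let: (rung, rail0, rail1) := c in
  if o is Some b then (if b then rail1 else rail0) else rung.

Definition empty_column : column := (false, false, false).
Definition rung_column : column := (true, false, false).

Definition column_size (c : column) : nat := \sum_o selects o c.

Definition column_degree (b : bool) (p c : column) : nat :=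
  selects (Some b) p + selects None c + selects (Some b) c.

Lemma big_option (R : Type) (idx : R) (op : Monoid.com_law idx) (T : finType)
    (F : option T -> R) :
  \big[op/idx]_o F o = op (F None) (\big[op/idx]_x F (Some x)).
Proof.
rewrite (bigD1 None) //= (reindex_omap Some id) => [|[]//]; congr (op _ _).
by apply: eq_bigl => x; rewrite eqxx.
Qed.

Lemma column_sizeE rung rail0 rail1 :
  column_size (rung, rail0, rail1) = rung + rail0 + rail1.
Proof. by rewrite /column_size big_option big_bool /= -addnA (addnC rail0). Qed.

Section LadderWords.
Variable n : nat.
Implicit Types (t : n.-tuple column) (x : bool * 'I_n) (p : option bool * 'I_n).
Implicit Types M : {set {set bool * 'I_n}}.

(* In the last column, [Some b] stands for no edge of the ladder: its set of
   endpoints is a singleton. *)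
Definition endpoints p : {set bool * 'I_n} :=
  if p.1 is Some b then
    [set x : bool * 'I_n | (x.1 == b) && (p.2 <= x.2 <= p.2.+1)]
  else [set x | x.2 == p.2].

Definition is_edge p : bool := (p.1 == None) || (p.2.+1 < n).

Lemma endpoints_inj : injective endpoints.
Proof.
move=> [u i] [v j] /setP E.
have ij : i = j.
  have := E (odflt false u, i); have := E (odflt false v, j).
  rewrite /endpoints; case: u v {E} => [b|] [b'|];
    rewrite !inE /= ?eqxx -?(inj_eq val_inj) /= => Ej Ei;
    apply/val_inj => /=; lia.
congr pair => //; move: E; rewrite {}ij => E.
have := E (false, j); have := E (true, j).
by case: u v {E} => [[]|] [[]|] //;
  rewrite /endpoints !inE /= ?eqxx ?leqnn ?leqnSn.
Qed.

Lemma ladder_edgeP (e : {set bool * 'I_n}) :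
  reflect (exists2 p, is_edge p & e = endpoints p) (e \in edges (ladder n)).
Proof.
have rail b (i j : 'I_n) : i.+1 = j ->
    endpoints (Some b, i) = [set (b, i); (b, j)].
  move=> ij; apply/setP=> -[c k]; rewrite !inE /= !xpair_eqE.
  rewrite -andb_orr -!(inj_eq val_inj k) /= -ij; congr andb; lia.
have rung b (i : 'I_n) : endpoints (None, i) = [set (b, i); (~~ b, i)].
  apply/setP=> -[c k]; rewrite !inE /= !xpair_eqE -andb_orl.
  by case: b c => [] [].
rewrite inE; apply: (iffP existsP) => [[x /existsP[y /andP[]]]|[[u i] ei ->]].
  case: x y => b i [c j] /orP[/andP[/= /eqP<- /orP[]/eqP ij]|/= ] /eqP.
  - rewrite -(rail b i j ij) => ->; exists (Some b, i) => //.
    by rewrite /is_edge ij /=.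
  - rewrite setUC -(rail b j i ij) => ->; exists (Some b, j) => //.
    by rewrite /is_edge ij /=.
  - move=> /eqP/andP[bc /eqP<-] /eqP->; exists (None, i) => //.
    by rewrite (rung b); case: b c bc => [] [].
case: u ei => [b|] ei.
  exists (b, i); apply/existsP; exists (b, Ordinal ei).
  by rewrite (rail b i (Ordinal ei)) //= /ladder_adj /= !eqxx.
exists (false, i); apply/existsP; exists (true, i).
by rewrite (rung false) /= /ladder_adj /= !eqxx.
Qed.

Definition decode t : {set {set bool * 'I_n}} :=
  [set endpoints p | p in [pred p | selects p.1 (tnth t p.2)]].

Definition encode M : n.-tuple column :=
  [tuple (endpoints (None, i) \in M, endpoints (Some false, i) \in M,
          endpoints (Some true, i) \in M) | i < n].

Lemma mem_decode t p : (endpoints p \in decode t) = selects p.1 (tnth t p.2).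
Proof. by rewrite mem_imset //; exact: endpoints_inj. Qed.

Lemma selects_encode M p :
  selects p.1 (tnth (encode M) p.2) = (endpoints p \in M).
Proof. by case: p => [[[]|] i]; rewrite tnth_mktuple. Qed.

Lemma decodeK : cancel decode encode.
Proof.
move=> t; apply: eq_from_tnth => i; rewrite tnth_mktuple !mem_decode /=.
by case: (tnth t i) => [[]].
Qed.

Lemma encodeK M : M \subset edges (ladder n) -> decode (encode M) = M.
Proof.
move=> /subsetP ME; apply/setP=> e; apply/imsetP/idP => [[p]|eM].
  by rewrite inE selects_encode => pM ->.
have /ladder_edgeP[p _ ep] := ME _ eM; exists p => //.
by rewrite inE selects_encode -ep.
Qed.

Lemma card_decode_if t (P : pred {set bool * 'I_n}) :
  #|[set e in decode t | P e]|
  = \sum_o \sum_(i < n | P (endpoints (o, i))) selects o (tnth t i).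
Proof.
have -> : [set e in decode t | P e]
    = endpoints @: [set p | selects p.1 (tnth t p.2) & P (endpoints p)].
  apply/setP=> e; rewrite !inE.
  apply/andP/imsetP => [[/imsetP[p sp ->] Pp]|[p]].
    by exists p => //; rewrite inE -topredE /= in sp *; rewrite sp.
  by rewrite inE => /andP[sp Pp] ->; rewrite mem_decode.
rewrite card_imset; last exact: endpoints_inj.
rewrite -sum1dep_card big_mkcond pair_big_dep /= [RHS]big_mkcond.
by apply: eq_bigr => -[u i] _; case: (P _); case: selects.
Qed.

Lemma card_decode t : #|decode t| = \sum_(c <- t) column_size c.
Proof.
have -> : decode t = [set e in decode t | true].
  by apply/setP=> e; rewrite inE andbT.
by rewrite card_decode_if exchange_big big_tuple.
Qed.

(* The rung in front of the first column covers both rows, so that it imposes no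
   constraint on that column. *)
Definition padded t : nat -> column :=
  nth empty_column [:: empty_column, rung_column & t].

Lemma padded_tnth t (i : 'I_n) : padded t i.+2 = tnth t i.
Proof. by rewrite (tnth_nth empty_column). Qed.

Lemma sum_selects_pred t b (i : 'I_n) :
  \sum_(j < n | i == j.+1 :> nat) selects (Some b) (tnth t j)
  = selects (Some b) (padded t i.+1).
Proof.
case: i => -[|i] lt_i /=; first by rewrite big_pred0 //; case: b.
by rewrite (big_pred1 (Ordinal (ltnW lt_i))) -?padded_tnth.
Qed.

Lemma degree_decode t x :
  degree (decode t) x = column_degree x.1 (padded t x.2.+1) (padded t x.2.+2).
Proof.
case: x => b i.
rewrite /degree card_decode_if big_option big_bool padded_tnth /=.
have rung : \sum_(j < n | (b, i) \in endpoints (None, j))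
      selects None (tnth t j)
    = selects None (tnth t i).
  by rewrite (big_pred1 i) // => j; rewrite !inE eq_sym.
have rail c : \sum_(j < n | (b, i) \in endpoints (Some c, j))
      selects (Some c) (tnth t j)
    = if c == b then selects (Some b) (padded t i.+1)
        + selects (Some b) (tnth t i) else 0.
  case: eqVneq => [->|cb]; last first.
    by rewrite big_pred0 // => j; rewrite !inE /= eq_sym (negbTE cb).
  rewrite (bigD1 i) /=; last by rewrite !inE /= eqxx leqnn leqnSn.
  rewrite addnC -sum_selects_pred; congr addn; apply: eq_bigl => j.
  by rewrite !inE /= eqxx -(inj_eq val_inj j) /=; lia.
by rewrite rung !rail /column_degree {rung rail}; case: b => /=; lia.
Qed.

Lemma decode_edges t :
  (decode t \subset edges (ladder n))
  = [forall b, ~~ selects (Some b) (last rung_column t)].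
Proof.
apply/subsetP/forallP => [sub b|no_rail e /imsetP[[[b|] i] /= sel ->]];
  last first.
- by apply/ladder_edgeP; exists (None, i).
- apply/ladder_edgeP; exists (Some b, i) => //; rewrite /is_edge /= ltnNge.
  apply/negP => ni; have /negP[] := no_rail b; rewrite -nth_last size_tuple.
  have -> : n.-1 = i by have := ltn_ord i; lia.
  by rewrite -tnth_nth; exact: sel.
apply/negP; rewrite -nth_last size_tuple.
have [nlt|] := ltnP n.-1 n; last first.
  by move=> ?; rewrite nth_default ?size_tuple //; case: b.
rewrite -[n.-1]/(val (Ordinal nlt)) -tnth_nth -(mem_decode t (Some b, _)).
move=> /sub/ladder_edgeP[q qe /endpoints_inj eq_q].
by move: qe; rewrite -eq_q /is_edge /=; lia.
Qed.

Lemma nu_ladder : nu (ladder n) = n.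
Proof.
apply/eqP; rewrite eqn_leq; apply/andP; split.
  apply/bigmax_leqP => M /card_matching.
  by rewrite card_prod card_bool card_ord mul2n leq_double.
pose t := [tuple of nseq n rung_column].
have rail_free k b : ~~ selects (Some b) (padded t k).
  by case: k b => [|[|k]] []; rewrite /padded //= nth_nseq; case: ifP.
have matching_t : @matching (ladder n) (decode t).
  rewrite /matching decode_edges; apply/andP; split.
    apply/forallP => b; have := mem_last rung_column t.
    by rewrite inE mem_nseq => /orP[|/andP[_]] /eqP->; case: b.
  apply/trivIset_degreeP => x; rewrite degree_decode /column_degree.
  by rewrite !(negbTE (rail_free _ _)) addn0 leq_b1.
apply: leq_trans (leq_bigmax_cond _ matching_t).
by rewrite card_decode big_nseq iter_addn_0 column_sizeE mul1n.
Qed.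

Lemma edges_meetP (P : pred (bool * 'I_n)) :
  (forall e, e \in edges (ladder n) -> exists2 x, x \in e & P x)
  <-> (forall i, P (false, i) || P (true, i))
      /\ (forall b (i : 'I_n) (lt_i : i.+1 < n),
             P (b, i) || P (b, Ordinal lt_i)).
Proof.
split=> [meet|[rung rail] e /ladder_edgeP[[[b|] i] lt_i ->]]; last 2 first.
- have /orP[Pi|Pi] := rail b i lt_i.
    by exists (b, i); rewrite // !inE /=; lia.
  by exists (b, Ordinal lt_i); rewrite // !inE /=; lia.
- have /orP[Pi|Pi] := rung i; first by exists (false, i); rewrite ?inE.
  by exists (true, i); rewrite ?inE.
split=> [i|b i lt_i].
  have /meet[[b j]] : endpoints (None, i) \in edges (ladder n).
    by apply/ladder_edgeP; exists (None, i).
  by rewrite inE => /eqP/= ->; case: b => ->; rewrite ?orbT.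
have /meet[[c j]] : endpoints (Some b, i) \in edges (ladder n).
  by apply/ladder_edgeP; exists (Some b, i).
rewrite !inE /= => /andP[/eqP-> ij] Pj; apply/orP.
have [ji|ji] : j = i :> nat \/ j = i.+1 :> nat by lia.
  by left; rewrite -(_ : j = i) //; apply/val_inj.
by right; rewrite -(_ : j = Ordinal lt_i) //; apply/val_inj.
Qed.

End LadderWords.

(** * Local maximality as an automaton *)

Definition vertex_ok (b : bool) (p q c : column) : bool :=
  (column_degree b q c <= 1)
  && ((0 < column_degree b p q) || (0 < column_degree b q c)).

Definition locally_maximal (p q c : column) : bool :=
  [&& vertex_ok false p q c, vertex_ok true p q c
    & (0 < column_degree false q c) || (0 < column_degree true q c)].

(* [Covered] means covered, but not by the edge to the next column. *)
Inductive vertex_state := MatchedRight | Covered | Free.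

Definition vertex_state_of (b : bool) (p q : column) : vertex_state :=
  if selects (Some b) q then MatchedRight
  else if 0 < column_degree b p q then Covered else Free.

(* A vertex next to a free one must be covered, as otherwise the edge between
   them could be added; for the same reason [ladder_step] forbids two free
   vertices in one column. *)
Definition vertex_step (v : vertex_state) (rung rail : bool) :
    option vertex_state :=
  match v, rung, rail with
  | MatchedRight, false, false | (Covered | Free), true, false => Some Covered
  | (Covered | Free), false, true => Some MatchedRight
  | Covered, false, false => Some Free
  | _, _, _ => None
  end.

Lemma vertex_stepE b p q c :
  vertex_step (vertex_state_of b p q) (selects None c) (selects (Some b) c)
  = if vertex_ok b p q c then Some (vertex_state_of b q c) else None.
Proof.
rewrite /vertex_ok /vertex_state_of /column_degree.
by do 5!case: (selects _ _).
Qed.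

Definition column_state := (vertex_state * vertex_state)%type.

Definition state_of (p q : column) : column_state :=
  (vertex_state_of false p q, vertex_state_of true p q).

Definition ladder_step (s : column_state) (c : column) : option column_state :=
  let: (rung, rail0, rail1) := c in
  match vertex_step s.1 rung rail0, vertex_step s.2 rung rail1 with
  | Some Free, Some Free => None
  | Some v, Some w => Some (v, w)
  | _, _ => None
  end.

Definition ladder_final (s : column_state) : bool :=
  match s with (MatchedRight, _) | (_, MatchedRight) => false | _ => true end.

Lemma ladder_stepE p q c :
  ladder_step (state_of p q) c
  = if locally_maximal p q c then Some (state_of q c) else None.
Proof.
have := vertex_stepE true p q c; have := vertex_stepE false p q c.
rewrite /locally_maximal /state_of.
case: c => -[rung rail0] rail1 /= -> ->.
do 2!case: ifP => _ //=; last by case: (vertex_state_of _ _ _).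
rewrite /vertex_state_of /column_degree /=.
by do 2!case: (selects _ q); case: rung; case: rail0; case: rail1.
Qed.

Lemma ladder_finalE p q :
  ladder_final (state_of p q)
  = ~~ selects (Some false) q && ~~ selects (Some true) q.
Proof.
rewrite /state_of /vertex_state_of.
by do 2!case: (selects _ q); do 2?case: ifP.
Qed.

Lemma ladder_acceptsP p q s :
  reflect ((forall k, k < size s ->
      locally_maximal (nth empty_column [:: p, q & s] k)
        (nth empty_column [:: p, q & s] k.+1)
        (nth empty_column [:: p, q & s] k.+2))
    /\ forall b, ~~ selects (Some b) (last q s))
  (accepts ladder_step ladder_final (state_of p q) s).
Proof.
elim: s p q => [|c s IH] p q.
  rewrite -[accepts _ _ _ _]/(ladder_final (state_of p q)) ladder_finalE.
  apply: (iffP andP) => [[q0 q1]|[_ noq]]; last by split; exact: noq.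
  by split=> // -[].
rewrite [accepts _ _ _ _]/= ladder_stepE; case: ifP => [pqc|/negP not_pqc] /=.
  apply: (iffP (IH q c)) => -[loc last_s]; split=> // k; last exact: (loc k.+1).
  by case: k => // k; exact: loc.
by apply: ReflectF => -[/(_ 0 isT)].
Qed.

Lemma maximal_decode n (t : n.-tuple column) :
  maxset (@matching (ladder n)) (decode t)
  = accepts ladder_step ladder_final (Covered, Covered) t.
Proof.
apply/maximal_matchingP/(ladder_acceptsP empty_column rung_column).
  rewrite size_tuple -/(padded t) => -[/andP[]]; rewrite decode_edges.
  move=> /forallP last_t /trivIset_degreeP deg_le1 /edges_meetP[rung rail].
  split=> // k kn.
  have := rung (Ordinal kn); rewrite !degree_decode /= => rung_k.
  have ok b : vertex_ok b (padded t k) (padded t k.+1) (padded t k.+2).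
    have := deg_le1 (b, Ordinal kn).
    rewrite /vertex_ok degree_decode /= => -> /=.
    case: k kn {rung_k} => [|k] kn; first by rewrite /column_degree /= addn1.
    by have := rail b (Ordinal (ltnW kn)) kn; rewrite !degree_decode.
  by rewrite /locally_maximal !ok.
rewrite size_tuple -/(padded t) => -[loc last_t]; split.
  rewrite /matching decode_edges; apply/andP; split; first exact/forallP.
  apply/trivIset_degreeP => -[b i]; rewrite degree_decode.
  by have /and3P[/andP[? _] /andP[? _] _] := loc i (ltn_ord i); case: b.
apply/edges_meetP; split=> [i|b i lt_i]; rewrite !degree_decode.
  by have /and3P[] := loc i (ltn_ord i).
by have /and3P[/andP[_ ?] /andP[_ ?] _] := loc _ lt_i; case: b.
Qed.

Local Open Scope ring_scope.

Section LadderTransfer.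
Variable K : comNzRingType.

Definition ladder_sum : nat -> column_state -> {poly K} :=
  word_sum ladder_step ladder_final (fun c => 'X^(column_size c)).

Lemma maximal_matching_poly_ladder n :
  maximal_matching_poly K (ladder n) = ladder_sum n (Covered, Covered).
Proof.
rewrite /maximal_matching_poly (reindex_onto (@decode n) (@encode n)) => [|M].
  apply: eq_big => t; first by rewrite inE maximal_decode decodeK eqxx andbT.
  by rewrite card_decode prodrXr.
by rewrite inE => /maxsetp/andP[/encodeK].
Qed.

Lemma ladder_sum_swap k v w : ladder_sum k (v, w) = ladder_sum k (w, v).
Proof.
pose swap_rows (c : column) : column := (c.1.1, c.2, c.1.2).
have swapK : involutive swap_rows by case=> [[]].
apply: (word_sum_symmetry (f := fun s => (s.2, s.1)) (inv_bij swapK)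
  _ _ _ k (w, v)) => [c|[x y] c|[[] []]] //.
  by case: c => -[rung rail0] rail1; rewrite !column_sizeE addnAC.
case: c => -[rung rail0] rail1 /=.
by case: (vertex_step x _ _) => [[]|] //; case: (vertex_step y _ _) => [[]|].
Qed.

Lemma ladder_sumS k s :
  ladder_sum k.+1 s = \sum_(rung : bool) \sum_(rail0 : bool) \sum_(rail1 : bool)
    oapp (fun s' => 'X^(rung + rail0 + rail1) * ladder_sum k s') 0
      (ladder_step s (rung, rail0, rail1)).
Proof.
rewrite /ladder_sum word_sumS !pair_bigA /=.
by apply: eq_bigr => -[[rung rail0] rail1] _; rewrite column_sizeE.
Qed.
Lemma ladder_sum_right_right k :
  ladder_sum k.+1 (MatchedRight, MatchedRight)
  = ladder_sum k (Covered, Covered).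
Proof. by rewrite ladder_sumS !big_bool /= !add0r mul1r. Qed.

Lemma ladder_sum_right_free k :
  ladder_sum k.+1 (MatchedRight, Free)
  = 'X * ladder_sum k (MatchedRight, Covered).
Proof.
by rewrite ladder_sumS !big_bool /= !add0r !addr0 ladder_sum_swap.
Qed.

Lemma ladder_sum_right_covered k :
  ladder_sum k.+1 (MatchedRight, Covered)
  = 'X * ladder_sum k (MatchedRight, Covered) + ladder_sum k (Covered, Free).
Proof.
by rewrite ladder_sumS !big_bool /= !add0r ladder_sum_swap mul1r.
Qed.

Lemma ladder_sum_covered_free k :
  ladder_sum k.+1 (Covered, Free)
  = 'X * ladder_sum k (Covered, Covered)
    + 'X^2 * ladder_sum k (MatchedRight, MatchedRight)
    + 'X * ladder_sum k (MatchedRight, Free).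
Proof.
rewrite ladder_sumS !big_bool /= !add0r !addr0.
by rewrite (ladder_sum_swap k Free) addrA.
Qed.

Lemma ladder_sum_covered_covered k :
  ladder_sum k.+1 (Covered, Covered)
  = 'X * ladder_sum k (Covered, Covered)
    + 'X^2 * ladder_sum k (MatchedRight, MatchedRight)
    + 'X * ladder_sum k (MatchedRight, Free) *+ 2.
Proof.
rewrite ladder_sumS !big_bool /= !add0r !addr0.
by rewrite (ladder_sum_swap k Free) !addrA.
Qed.

Definition ladder_sumE := (ladder_sum_covered_covered, ladder_sum_covered_free,
  ladder_sum_right_covered, ladder_sum_right_free, ladder_sum_right_right).

Lemma maximal_matching_poly_ladder_rec n :
  maximal_matching_poly K (ladder n.+4.+1)
  = 'X * maximal_matching_poly K (ladder n.+4) *+ 2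
    + ('X^2 - 'X^3) * maximal_matching_poly K (ladder n.+2)
    + 'X^3 * maximal_matching_poly K (ladder n.+1)
    + 'X^4 * maximal_matching_poly K (ladder n).
Proof.
rewrite !maximal_matching_poly_ladder !ladder_sumE; ring.
Qed.

End LadderTransfer.

Local Open Scope classical_set_scope.
Local Open Scope ring_scope.

(** * Linear recurrences with a dominant root *)

Lemma powR_invnK (R : realType) (x : R) n :
  0 <= x -> (0 < n)%N -> (x `^ n%:R^-1) ^+ n = x.
Proof.
move=> x_ge0 n_gt0; rewrite -powR_mulrn ?powR_ge0 // -powRrM mulVf ?powRr1 //.
by rewrite pnatr_eq0 -lt0n.
Qed.

Lemma cvg_telescope_mean (R : archiRealFieldType) (u : R^nat) (l : R) :
  telescope u @ \oo --> l -> (fun n => u n / n%:R) @ \oo --> l.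
Proof.
move=> /cesaro; rewrite /arithmetic_mean telescopeK => mean_cvg.
rewrite -cvg_shiftS -[l]addr0 -[X in _ + X](mulr0 (u 0%N)).
rewrite [X in X @ _](_ : _ = (fun n => n.+1%:R^-1 * (u n.+1 - u 0%N))
  \+ (fun n => u 0%N * harmonic n)).
  by apply: cvgD mean_cvg _; apply: cvgMl_tmp; exact: cvg_harmonic.
by apply/funext => n /=; rewrite mulrBr [in LHS]mulrC [u 0%N * _]mulrC subrK.
Qed.

Lemma exists_expr_ge (R : realType) (s : R) d :
  0 <= s < 1 -> exists2 theta : R, 0 < theta < 1 & s <= theta ^+ d.
Proof.
move=> /andP[s_ge0 s_lt1]; pose rho := (1 + s) / 2.
have [rho_gt0 rho_lt1 s_rho] : [/\ 0 < rho, rho < 1 & s <= rho].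
  by rewrite /rho; split; lra.
pose theta := rho `^ d.+1%:R^-1; have theta_gt0 : 0 < theta by exact: powR_gt0.
have thetaX : theta ^+ d.+1 = rho by rewrite powR_invnK ?ltW.
have theta_lt1 : theta < 1.
  rewrite ltNge; apply: contraL rho_lt1 => /(exprn_ege1 d.+1).
  by rewrite thetaX -leNgt.
exists theta; first by rewrite theta_gt0.
by rewrite (le_trans s_rho) // -thetaX exprS ler_piMl ?exprn_ge0 ?ltW.
Qed.

Section Contraction.
Variables (R : realType) (d : nat) (k : 'I_d -> R).
Hypotheses (k_ge0 : forall i, 0 <= k i) (k_lt1 : \sum_i k i < 1).

Lemma contraction_geometric_bound (theta eps : R) (u : R^nat) :
  0 < theta <= 1 -> \sum_i k i <= theta ^+ d -> 0 <= eps ->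
  (forall n, 0 <= u n) ->
  (forall n,
    u (n + d)%N <= \sum_i k i * u (n + i)%N + eps * (1 - \sum_i k i)) ->
  forall n, u n <= eps + (\sum_(i < d) u i) / theta ^+ d * theta ^+ n.
Proof.
move=> /andP[th_gt0 th_le1] k_th eps_ge0 u_ge0 u_rec.
set B := _ / _; have B_ge0 : 0 <= B.
  by rewrite divr_ge0 ?sumr_ge0 // exprn_ge0 ?ltW.
elim/ltn_ind=> n IH; have [n_d|d_n] := ltnP n d.
  apply: (@le_trans _ _ (B * theta ^+ d)).
    rewrite divfK ?expf_neq0 ?gt_eqF // (bigD1 (Ordinal n_d)) //= lerDl.
    exact: sumr_ge0.
  rewrite -[leLHS]add0r lerD // ler_wpM2l //.
  by rewrite ler_wiXn2l ?(ltW th_gt0) ?(ltnW n_d).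
rewrite -(subnK d_n); set j := (n - d)%N.
have k_u : \sum_i k i * u (j + i)%N
    <= eps * \sum_i k i + (\sum_i k i) * (B * theta ^+ j).
  rewrite mulrC -mulrDr mulr_suml.
  apply: ler_sum => i _; apply: ler_wpM2l => //.
  apply: le_trans (IH _ _) _; first by rewrite /j; have := ltn_ord i; lia.
  rewrite lerD2l ler_wpM2l // exprD ler_piMr //.
    by rewrite exprn_ge0 ?ltW.
  by rewrite exprn_ile1 ?(ltW th_gt0).
have k_tail : (\sum_i k i) * (B * theta ^+ j) <= B * theta ^+ (j + d).
  by rewrite mulrC exprD mulrA ler_wpM2l // mulr_ge0 ?exprn_ge0 ?(ltW th_gt0).
have := u_rec j; move: (\sum_i k i * _) (\sum_i k i) k_u k_tail => x s; lra.
Qed.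

Lemma cvg0_contraction (u w : R^nat) :
  (forall n, 0 <= u n) ->
  (forall n, u (n + d)%N <= \sum_i k i * u (n + i)%N + w n) ->
  w @ \oo --> 0 -> u @ \oo --> 0.
Proof.
move=> u_ge0 u_rec w_cvg; apply/cvgr0Pnorm_le => e e_gt0.
have [theta /andP[th_gt0 th_lt1] k_theta] : exists2 theta : R,
    0 < theta < 1 & \sum_i k i <= theta ^+ d.
  by apply: exists_expr_ge; rewrite k_lt1 sumr_ge0.
have e2_gt0 : 0 < e / 2 by rewrite divr_gt0.
have /cvgr0Pnorm_le/(_ (e / 2 * (1 - \sum_i k i))) := w_cvg.
rewrite mulr_gt0 ?subr_gt0 // => /(_ isT)[N _ w_small].
pose B := (\sum_(i < d) u (N + i)%N) / theta ^+ d.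
have u_le m : u (N + m)%N <= e / 2 + B * theta ^+ m.
  apply: (@contraction_geometric_bound _ _ (fun m => u (N + m)%N)) => //=.
  - by rewrite th_gt0 ltW.
  - exact: ltW.
  move=> {}m; have := u_rec (N + m)%N; rewrite -addnA => /le_trans; apply.
  rewrite lerD //; first by apply: ler_sum => i _; rewrite addnA.
  by apply: le_trans (ler_norm _) (w_small _ _); exact: leq_addr.
have norm_theta : `|theta| < 1 by rewrite gtr0_norm.
have /cvgr0Pnorm_le/(_ _ e2_gt0)[M _ geom_small] := cvg_geometric B norm_theta.
exists (N + M)%N => // n /= NM_n; rewrite ger0_norm //.
have N_n : (N <= n)%N by rewrite (leq_trans _ NM_n) ?leq_addr.
rewrite -(subnKC N_n) (le_trans (u_le _)) // [leRHS](splitr e) lerD2l.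
by apply: le_trans (ler_norm _) (geom_small _ _); rewrite /= leq_subRL.
Qed.

End Contraction.

Section PolyShift.
Variable K : comNzRingType.
Implicit Types (p q : {poly K}) (u : nat -> K).

(* [p(S) u] for the shift operator [S]. *)
Definition poly_shift p u n : K := \sum_(i < size p) p`_i * u (n + i)%N.

Lemma poly_shift_widen m p u n :
  (size p <= m)%N -> poly_shift p u n = \sum_(i < m) p`_i * u (n + i)%N.
Proof.
move=> pm; rewrite /poly_shift.
rewrite (big_ord_widen m (fun i => p`_i * u (n + i)%N)) // big_mkcond /=.
apply: eq_bigr => i _.
by case: ltnP => // /(nth_default 0)->; rewrite mul0r.
Qed.

Lemma poly_shift_Poly s u n :
  poly_shift (Poly s) u n = \sum_(i < size s) s`_i * u (n + i)%N.
Proof.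
rewrite (poly_shift_widen _ _ (size_Poly s)).
by apply: eq_bigr => i _; rewrite coef_Poly.
Qed.

Lemma poly_shift_diff p c u n :
  poly_shift p (fun k => u k.+1 - c * u k) n
  = poly_shift p u n.+1 - c * poly_shift p u n.
Proof.
rewrite /poly_shift mulr_sumr -sumrB; apply: eq_bigr => i _.
by rewrite mulrBr addSn mulrCA.
Qed.

Lemma poly_shift_XsubC_mul p c u n :
  poly_shift (('X - c%:P) * p) u n
  = poly_shift p u n.+1 - c * poly_shift p u n.
Proof.
have size_le : (size (('X - c%:P) * p)%R <= (size p).+1)%N.
  by rewrite (leq_trans (size_polyMleq _ _)) // size_XsubC.
rewrite (poly_shift_widen _ _ size_le).
under eq_bigr do rewrite mulrBl coefB coefXM coefCM mulrBl.
rewrite sumrB big_ord_recl /= mul0r add0r; congr (_ - _).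
  by apply: eq_bigr => i _; rewrite addnS.
rewrite (poly_shift_widen _ _ (leqnSn _)) mulr_sumr.
by apply: eq_bigr => i _; rewrite mulrA.
Qed.

End PolyShift.

Section DominantRoot.
Variables (R : realType) (p : {poly R}) (r : R).
Hypothesis r_gt0 : 0 < r.
(* This forces the roots of [p] into the disc [|z| < r]. *)
Hypothesis p_dominated :
  \sum_(i < (size p).-1) `|p`_i| * r ^+ i < `|lead_coef p| * r ^+ (size p).-1.

Let rX_gt0 n : 0 < r ^+ n. Proof. exact: exprn_gt0. Qed.

Let rX_neq0 n : r ^+ n != 0. Proof. by rewrite gt_eqF. Qed.

Let norm_rX n : `|r ^+ n| = r ^+ n. Proof. exact/ger0_norm/ltW. Qed.

Let size_p : size p = (size p).-1.+1.
Proof.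
rewrite prednK // size_poly_gt0; apply: contraTneq p_dominated => ->.
by rewrite size_poly0 big_ord0 lead_coef0 normr0 mul0r ltxx.
Qed.

Lemma dominated_horner_neq0 : p.[r] != 0.
Proof.
apply: contraTneq p_dominated => pr0; rewrite -leNgt.
have lead_term : lead_coef p * r ^+ (size p).-1
    = - \sum_(i < (size p).-1) p`_i * r ^+ i.
  apply/eqP; rewrite -addr_eq0 -[X in _ == X]pr0 horner_coef.
  by rewrite [in eqbRHS]size_p big_ord_recr addrC.
rewrite -norm_rX -normrM lead_term normrN.
apply: le_trans (ler_norm_sum _ _ _) _; apply: ler_sum => i _.
by rewrite normrM norm_rX.
Qed.

Let poly_shift_rescale (q : {poly R}) (u : R^nat) n :
  poly_shift q u n / r ^+ n
  = \sum_(i < size q) q`_i * r ^+ i * (u (n + i)%N / r ^+ (n + i)).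
Proof.
rewrite /poly_shift mulr_suml; apply: eq_bigr => i _.
by rewrite exprD; field; rewrite !rX_neq0.
Qed.

Lemma cvg_poly_shift (q : {poly R}) (u : R^nat) (l : R) :
  (fun n => u n / r ^+ n) @ \oo --> l ->
  (fun n => poly_shift q u n / r ^+ n) @ \oo --> q.[r] * l.
Proof.
move=> u_cvg; rewrite horner_coef mulr_suml.
under eq_fun do rewrite poly_shift_rescale.
apply: cvg_big => [|i _]; first exact: add_continuous.
by apply: cvgMl_tmp; rewrite (cvg_shiftn i (fun n => u n / r ^+ n)).
Qed.

Lemma cvg0_dominated (u : R^nat) :
  (fun n => poly_shift p u n / r ^+ n) @ \oo --> 0 ->
  (fun n => u n / r ^+ n) @ \oo --> 0.
Proof.
move=> shift_cvg; apply: norm_cvg0; set d := (size p).-1.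
pose y n := u n / r ^+ n; pose err n := poly_shift p u n / r ^+ n.
pose lead := `|lead_coef p| * r ^+ d.
have lead_gt0 : 0 < lead.
  apply: le_lt_trans p_dominated; apply: sumr_ge0 => i _.
  by rewrite mulr_ge0 // ltW.
have y_rec n : lead_coef p * r ^+ d * y (n + d)%N
    = err n - \sum_(i < d) p`_i * r ^+ i * y (n + i)%N.
  by rewrite /err poly_shift_rescale size_p big_ord_recr /= addrC addrK.
pose k (i : 'I_d) := `|p`_i| * r ^+ i / lead.
apply: (@cvg0_contraction _ d k _ _ (fun n => `|y n|)
  (fun n => `|err n| / lead)) => [i||n|n|] //.
- by rewrite divr_ge0 ?(ltW lead_gt0) // mulr_ge0 // ltW.
- by rewrite -mulr_suml ltr_pdivrMr // mul1r.
- rewrite -(ler_pM2l lead_gt0) {1}/lead -{1}norm_rX -!normrM y_rec.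
  rewrite mulrDr (mulrC _ (`|err n| / _)) divfK ?gt_eqF // [leRHS]addrC.
  rewrite (le_trans (ler_normB _ _)) // lerD2l mulr_sumr.
  apply: le_trans (ler_norm_sum _ _ _) _; apply: ler_sum => i _.
  by rewrite !normrM norm_rX [leRHS]mulrA [_ * k i]mulrC divfK ?gt_eqF.
- rewrite -[X in _ --> X](mul0r lead^-1) -(normr0 R).
  by apply: cvgMr_tmp; exact: cvg_norm.
Qed.

Lemma cvg_dominated (u : R^nat) (l : R) :
  (fun n => poly_shift p u n / r ^+ n) @ \oo --> l ->
  (fun n => u n / r ^+ n) @ \oo --> l / p.[r].
Proof.
move=> shift_cvg; set L := l / p.[r].
have u_split n : u n / r ^+ n = (u n - L * r ^+ n) / r ^+ n + L.
  by field; rewrite rX_neq0.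
rewrite (funext u_split).
rewrite -[X in _ --> X]add0r; apply: cvgD; last exact: cvg_cst.
apply: (@cvg0_dominated (fun n => u n - L * r ^+ n)).
have shift_split n : poly_shift p (fun n => u n - L * r ^+ n) n / r ^+ n
    = poly_shift p u n / r ^+ n - l.
  rewrite !poly_shift_rescale -[in RHS](divfK dominated_horner_neq0 l) -/L.
  rewrite horner_coef mulr_sumr -sumrB; apply: eq_bigr => i _.
  by field; rewrite rX_neq0.
rewrite (funext shift_split).
by rewrite -[X in _ --> X](subrr l); apply: cvgB => //; exact: cvg_cst.
Qed.

Lemma cvg_dominant_root (a : R^nat) :
  (forall n, poly_shift (('X - r%:P) * p) a n = 0) ->
  (fun n => a n / r ^+ n) @ \oo --> poly_shift p a 0 / p.[r].
Proof.
move=> a_rec; apply: cvg_dominated.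
have geom n : poly_shift p a n = r ^+ n * poly_shift p a 0.
  elim: n => [|n IH]; first by rewrite mul1r.
  have /eqP := a_rec n; rewrite poly_shift_XsubC_mul subr_eq0 => /eqP->.
  by rewrite IH exprS mulrA.
under eq_fun do rewrite geom mulrAC mulfV // mul1r.
exact: cvg_cst.
Qed.

(* The forcing term resonates with the root [r], so [b n] grows like
   [n * r ^+ n]. *)
Lemma cvg_resonance_ratio (q : {poly R}) (a b : R^nat) :
  (forall n, poly_shift (('X - r%:P) * p) a n = 0) ->
  (forall n, poly_shift (('X - r%:P) * p) b n = poly_shift q a n) ->
  poly_shift p a 0 != 0 ->
  (fun n => b n / (n%:R * a n)) @ \oo -->
    q.[r] / (r * (('X - r%:P) * p)^`().[r]).
Proof.
move=> a_rec b_rec a0; set c := poly_shift p a 0 in a0.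
have pr0 := dominated_horner_neq0; have a_cvg := cvg_dominant_root a_rec.
have c_neq0 : c / p.[r] != 0 by rewrite mulf_neq0 ?invr_eq0.
pose x n := b n / r ^+ n.
have x_cvg : telescope x @ \oo --> q.[r] * (c / p.[r]) / p.[r] / r.
  have -> : telescope x = (fun n => (b n.+1 - r * b n) / r ^+ n / r).
    apply/funext => n; rewrite /telescope /= /x exprS.
    by field; rewrite rX_neq0 gt_eqF.
  apply: cvgMr_tmp; apply: (@cvg_dominated (fun n => b n.+1 - r * b n)).
  under eq_fun do rewrite poly_shift_diff -poly_shift_XsubC_mul b_rec.
  exact: cvg_poly_shift.
have -> : q.[r] / (r * (('X - r%:P) * p)^`().[r])
    = q.[r] * (c / p.[r]) / p.[r] / r / (c / p.[r]).
  have -> : (('X - r%:P) * p)^`().[r] = p.[r].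
    rewrite derivM derivXsubC mul1r hornerD hornerM hornerXsubC.
    by rewrite subrr mul0r addr0.
  by field; rewrite pr0 a0 gt_eqF.
rewrite [X in X @ _](_ : _
  = (fun n => x n / n%:R) \* (fun n => (a n / r ^+ n)^-1)).
  apply: cvgM; first exact: cvg_telescope_mean.
  exact: cvgV.
apply/funext => n /=; rewrite /x !invfM invrK.
by rewrite (mulrC (a n)^-1) !mulrA (mulrAC _ _ (r ^+ n)) mulfVK // mulrAC.
Qed.

End DominantRoot.

(** * The limit for ladders *)

(* z^5 - 2 z^4 - z - 1, constant term first, is the recurrence of the maximal
   matching polynomials at ['X = 1]; [ladder_forcing] is minus its derivative in
   ['X] there. *)
Definition ladder_charpoly (K : nzRingType) : {poly K} :=
  Poly [:: -1; -1; 0; 0; -2; 1].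

Definition ladder_forcing (K : nzRingType) : {poly K} :=
  Poly [:: 4; 3; -1; 0; 2].

Definition ladder_cofactor (K : nzRingType) (r : K) : {poly K} :=
  Poly [:: r ^+ 2 - r - 2; 1 + 2 * r - r ^+ 2; r ^+ 2 - 2 * r; r - 2; 1].

Lemma T0_ladder_rec (K : comNzRingType) n :
  poly_shift (ladder_charpoly K) (fun k => (T0 (ladder k))%:R) n = 0.
Proof.
have := congr1 (horner^~ 1) (maximal_matching_poly_ladder_rec K n).
rewrite !hornerE !maximal_matching_poly_at1 => T0_rec.
rewrite poly_shift_Poly /= !big_ord_recr big_ord0 /= !addnS addn0 T0_rec.
by ring.
Qed.

Lemma T1_ladder_rec (K : comNzRingType) n :
  poly_shift (ladder_charpoly K) (fun k => (T1 (ladder k))%:R) n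
  = poly_shift (ladder_forcing K) (fun k => (T0 (ladder k))%:R) n.
Proof.
have := congr1 (fun p : {poly K} => p^`().[1])
  (maximal_matching_poly_ladder_rec K n).
rewrite !(derivD, derivN, derivM, derivMn, derivXn, derivX).
rewrite !(hornerD, hornerN, hornerM, hornerMn, hornerXn, hornerX, hornerC).
rewrite !maximal_matching_poly_at1 !deriv_maximal_matching_poly_at1 => T1_rec.
rewrite !poly_shift_Poly /= !big_ord_recr !big_ord0 /= !addnS addn0 T1_rec.
by ring.
Qed.

Lemma T0_ladder_small (K : comNzRingType) :
  [/\ (T0 (ladder 0))%:R = 1 :> K, (T0 (ladder 1))%:R = 1 :> K,
      (T0 (ladder 2))%:R = 2 :> K, (T0 (ladder 3))%:R = 5 :> K
    & (T0 (ladder 4))%:R = 11 :> K].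
Proof.
rewrite -!maximal_matching_poly_at1 !maximal_matching_poly_ladder.
rewrite !ladder_sumE /ladder_sum !word_sum0 /=.
by rewrite !(hornerD, hornerM, hornerMn, hornerX, hornerXn, horner0, hornerC);
  split; ring.
Qed.

Section LadderLimit.
Variables (R : realType) (r : R).
Hypotheses (r_gt0 : 0 < r) (r_cubic : r ^+ 3 = r ^+ 2 + 2 * r + 1).

Lemma ladder_root_bounds : 2 < r < 5 / 2.
Proof.
have r_factor : r * (r + 1) * (r - 2) = 1 by ring: r_cubic.
have r_gt2 : 2 < r.
  have r_gt : 0 < r * (r + 1) by rewrite mulr_gt0 // addr_gt0.
  by rewrite -subr_gt0 -(pmulr_rgt0 _ r_gt) r_factor.
rewrite r_gt2 ltNge; apply/negP => r_ge.
have : 5 / 2 * (7 / 2) <= r * (r + 1) by apply: ler_pM; lra.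
by nra.
Qed.

Lemma ladder_charpoly_factor :
  ladder_charpoly R = ('X - r%:P) * ladder_cofactor r.
Proof.
have rP_cubic : r%:P ^+ 3 = r%:P ^+ 2 + 2 * r%:P + 1.
  by rewrite -polyC_exp r_cubic; ring.
rewrite /ladder_charpoly /ladder_cofactor /Poly /= !cons_poly_def.
by ring: rP_cubic.
Qed.

Lemma ladder_cofactor_dominated :
  let p := ladder_cofactor r in
  \sum_(i < (size p).-1) `|p`_i| * r ^+ i < `|lead_coef p| * r ^+ (size p).-1.
Proof.
have /andP[r_gt2 r_lt] := ladder_root_bounds.
have rE : ladder_cofactor r = [:: r ^+ 2 - r - 2; 1 + 2 * r - r ^+ 2;
    r ^+ 2 - 2 * r; r - 2; 1] :> seq R.
  by apply: (@PolyK _ 0); exact: oner_neq0.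
rewrite /= lead_coefE rE /= !big_ord_recr big_ord0 /= normr1.
have linear_coef_ge0 : 0 <= 1 + 2 * r - r ^+ 2.
  rewrite -(pmulr_rge0 _ r_gt0) [leRHS](_ : _ = r ^+ 2 - r - 1); first by nra.
  by ring: r_cubic.
rewrite !ger0_norm //; [|nra..]; rewrite -subr_gt0.
rewrite [ltRHS](_ : _ = 6 + 7 * r - r ^+ 2); first by nra.
by ring: r_cubic.
Qed.

Lemma ladder_cofactor_shift_neq0 :
  poly_shift (ladder_cofactor r) (fun k => (T0 (ladder k))%:R) 0 != 0.
Proof.
have [T0_0 T0_1 T0_2 T0_3 T0_4] := T0_ladder_small R.
rewrite poly_shift_Poly !big_ord_recr big_ord0 /= !add0n.
rewrite T0_0 T0_1 T0_2 T0_3 T0_4 (_ : _ + _ = 2 * r * (r + 1)); last by ring.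
by rewrite !mulf_neq0 ?gt_eqF // addr_gt0.
Qed.

Lemma deriv_ladder_charpoly_root :
  r * (ladder_charpoly R)^`().[r] = 2 * r ^+ 4 + 4 * r + 5.
Proof.
rewrite /ladder_charpoly /Poly /= !cons_poly_def.
rewrite !(derivD, derivM, derivX, derivC) !(hornerD, hornerM, hornerX, hornerC).
by ring: r_cubic.
Qed.

Lemma cvg_avgI_ladder :
  (fun n => avgI R (ladder n)) @ \oo -->
    (2 * r ^+ 4 - r ^+ 2 + 3 * r + 4) / (2 * r ^+ 4 + 4 * r + 5).
Proof.
have T0_rec := T0_ladder_rec R; have T1_rec := T1_ladder_rec R.
rewrite ladder_charpoly_factor in T0_rec T1_rec.
have := cvg_resonance_ratio r_gt0 ladder_cofactor_dominated T0_rec T1_rec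
  ladder_cofactor_shift_neq0.
rewrite -ladder_charpoly_factor deriv_ladder_charpoly_root.
have -> : (ladder_forcing R).[r] = 2 * r ^+ 4 - r ^+ 2 + 3 * r + 4.
  by rewrite horner_Poly /=; ring.
apply: cvg_trans; apply: near_eq_cvg; exists 1%N => // n /= n_gt0.
by rewrite /avgI nu_ladder gtn_eqF.
Qed.

End LadderLimit.

Lemma cardano (R : realType) (x y p : R) : 0 <= x -> 0 <= y -> 0 <= p ->
  x * y = p ^+ 3 ->
  let t := x `^ 3^-1 + y `^ 3^-1 in t ^+ 3 = 3 * p * t + (x + y).
Proof.
move=> x_ge0 y_ge0 p_ge0 xy.
have := powR_invnK x_ge0 (n := 3) isT; have := powR_invnK y_ge0 (n := 3) isT.
have := powR_ge0 x 3^-1; have := powR_ge0 y 3^-1.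
move: (x `^ _) (y `^ _) => a b b_ge0 a_ge0 b3 a3 /=.
have ab : a * b = p.
  by apply/eqP; rewrite -(@eqrXn2 _ 3) ?mulr_ge0 // exprMn a3 b3 xy.
by rewrite -ab -a3 -b3; ring.
Qed.

Theorem theorem9 (R : realType) :
  let r : R := 3^-1 * (1 + ((47 + 3 * Num.sqrt 93) / 2) `^ 3^-1
                         + ((47 - 3 * Num.sqrt 93) / 2) `^ 3^-1) in
  (fun n : nat => avgI R (ladder n)) @ \oo -->
    (2 * r ^+ 4 - r ^+ 2 + 3 * r + 4) / (2 * r ^+ 4 + 4 * r + 5).
Proof.
set s := Num.sqrt 93; set x := (47 + 3 * s) / 2; set y := (47 - 3 * s) / 2.
have s_ge0 : 0 <= s by exact: sqrtr_ge0.
have s2 : s ^+ 2 = 93 by rewrite sqr_sqrtr.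
have x_ge0 : 0 <= x by rewrite /x; lra.
have y_ge0 : 0 <= y by rewrite /y; nra.
have xy : x * y = 7 ^+ 3.
  by rewrite /x /y; field: s2.
have := cardano x_ge0 y_ge0 (ler0n _ 7) xy.
have xyD : x + y = 47 by rewrite /x /y; field.
set t := _ + _ => t_cubic r; rewrite {}xyD in t_cubic.
have rE : r = 3^-1 * (1 + t) by rewrite /r /t addrA.
apply: cvg_avgI_ladder; rewrite rE.
  by rewrite mulr_gt0 ?invr_gt0 // ltr_wpDr // addr_ge0 ?powR_ge0.
by field: t_cubic.
Qed.
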